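(* Let $G$ be a finite connected graph without loops on vertices $v_1,\dots,v_n$, let $(\mathbf d,\mathbf r)$ be an arithmetical structure on $G$, let $L=\operatorname{diag}(\mathbf d)-A$, and let $L'$ be the $(n-1)\times(n-1)$ matrix with entries $\ell'_{i,j}=\ell_{i,j}\ell_{n,n}-\ell_{i,n}\ell_{n,j}$ ($i,j\in[n-1]$), i.e. the matrix $\operatorname{diag}(\mathbf d')-A'$ of the arithmetical structure $(G',\mathbf d',\mathbf r')$ obtained by the Keyes--Reiter operation at $v_n$. Then for all $k\in[n-2]$: (a) $D_k(L')=d_n^{k-1}D_{k+1}^*(L)$; (b) $d_n^{k-1}D_{k+1}(L)$ divides $D_k(L')$; (c) $D_k(L')$ divides $(g_n(L))^2 d_n^{k-1}D_{k+1}(L)$; (d) $d_n^{k-1}D_{k+1}(L)\leq D_k(L')\leq (g_n(L))^2d_n^{k-1}D_{k+1}(L)$.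
   Context: $G$ is a finite connected graph without loops (multiple edges allowed) with vertices $v_1,\dots,v_n$; $A$ is its adjacency matrix with entries $\delta_{i,j}$ = number of edges between $v_i$ and $v_j$ ($\delta_{i,i}=0$). An arithmetical structure is a pair $(\mathbf d,\mathbf r)\in\mathbb Z_{\ge0}^n\times\mathbb Z_{>0}^n$ with $(\operatorname{diag}(\mathbf d)-A)\mathbf r=\mathbf 0$ and $\gcd$ of entries of $\mathbf r$ equal to $1$. Write $L=\operatorname{diag}(\mathbf d)-A$ with entries $\ell_{i,j}$ (so $\ell_{n,n}=d_n$). The Keyes--Reiter operation at $v_n$ gives the graph $G'$ on $v_1,\dots,v_{n-1}$ with $\delta'_{i,j}=\delta_{i,j}d_n+\delta_{i,n}\delta_{n,j}$ edges between $v_i,v_j$ for $i\ne j$ and no loops, and $d'_i=d_id_n-\delta_{i,n}\delta_{n,i}$, $r'_i=r_i/\gcd_{j\in[n-1]}r_j$; $L'=\operatorname{diag}(\mathbf d')-A'$, whose entries equal $\ell_{i,j}\ell_{n,n}-\ell_{i,n}\ell_{n,j}$. For an integer matrix $B$ ($m\times n$), $D_k(B)$ is the gcd of all $k\times k$ minors ($D_0(B)=1$), $D_k^*(B)$ is the gcd of all $k\times k$ minors using the last row and last column, and $g_n(L)$ is the gcd of the entries of row $n$ of $L$. *)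

(* Defs.v *)
From mathcomp Require Import all_boot all_order all_algebra.

Set Implicit Arguments.
Unset Strict Implicit.
Unset Printing Implicit Defensive.

Import GRing.Theory.

(* Loopless multigraph on the vertices 'I_n, given by its edge multiplicities. *)
Record multigraph (n : nat) := Multigraph {
  mult : 'I_n -> 'I_n -> nat;
  mult_sym : forall i j, mult i j = mult j i;
  mult_loopless : forall i, mult i i = 0
}.

Definition adjacent n (G : multigraph n) : rel 'I_n :=
  fun i j => 0 < mult G i j.

Definition connected_graph n (G : multigraph n) : Prop :=
  forall i j, connect (adjacent G) i j.

Definition laplacian n (G : multigraph n) (d : 'I_n -> nat) : 'M[int]_n :=
  (diag_mx (\row_i (d i)%:Z) - \matrix_(i, j) (mult G i j)%:Z)%R.

Definition arithmetical_structure n (G : multigraph n) (d r : 'I_n -> nat) :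
    Prop :=
  [/\ forall i, 0 < r i,
      (laplacian G d *m \col_i (r i)%:Z = 0)%R
    & \big[gcdn/0]_i r i = 1].

Definition increasing_map k m (f : {ffun 'I_k -> 'I_m}) : bool :=
  [forall i : 'I_k, forall j : 'I_k, (i < j) ==> (f i < f j)].

Definition minor_abs k m n (B : 'M[int]_(m, n))
    (f : {ffun 'I_k -> 'I_m}) (g : {ffun 'I_k -> 'I_n}) : nat :=
  absz (\det (mxsub f g B))%R.

Definition D k m n (B : 'M[int]_(m, n)) : nat :=
  \big[gcdn/0]_(f : {ffun 'I_k -> 'I_m} | increasing_map f)
    \big[gcdn/0]_(g : {ffun 'I_k -> 'I_n} | increasing_map g)
      minor_abs B f g.

Definition Dstar k m n (B : 'M[int]_(m.+1, n.+1)) : nat :=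
  \big[gcdn/0]_(f : {ffun 'I_k -> 'I_m.+1} |
      increasing_map f && [exists i, f i == ord_max])
    \big[gcdn/0]_(g : {ffun 'I_k -> 'I_n.+1} |
        increasing_map g && [exists j, g j == ord_max])
      minor_abs B f g.

Definition last_row_gcd m n (B : 'M[int]_(m.+1, n)) : nat :=
  \big[gcdn/0]_j absz (B ord_max j).

(* [lift ord_max : 'I_n -> 'I_n.+1] is the inclusion of the first n indices. *)
Definition kr_matrix n (L : 'M[int]_n.+1) : 'M[int]_n :=
  (\matrix_(i, j)
     (L (lift ord_max i) (lift ord_max j) * L ord_max ord_max
      - L (lift ord_max i) ord_max * L ord_max (lift ord_max j)))%R.

(* The Keyes--Reiter operation at the last vertex. *)
Section KeyesReiter.
Variables (n : nat) (G : multigraph n.+1) (d r : 'I_n.+1 -> nat).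

Definition kr_mult (i j : 'I_n) : nat :=
  if i == j then 0
  else mult G (lift ord_max i) (lift ord_max j) * d ord_max
       + mult G (lift ord_max i) ord_max * mult G ord_max (lift ord_max j).

Lemma kr_mult_sym i j : kr_mult i j = kr_mult j i.
Proof.
rewrite /kr_mult eq_sym; case: eqP => // _.
congr (_ * _ + _); first exact: mult_sym.
by rewrite mulnC; congr (_ * _); exact: mult_sym.
Qed.

Lemma kr_mult_loopless i : kr_mult i i = 0.
Proof. by rewrite /kr_mult eqxx. Qed.

Definition kr_graph : multigraph n := Multigraph kr_mult_sym kr_mult_loopless.

(* The subtraction does not truncate when (d, r) is an arithmetical structure
   on G: see [kr_d_sub]. *)
Definition kr_d (i : 'I_n) : nat :=
  d (lift ord_max i) * d ord_max
  - mult G (lift ord_max i) ord_max * mult G ord_max (lift ord_max i).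

Definition kr_r (i : 'I_n) : nat :=
  r (lift ord_max i) %/ \big[gcdn/0]_(j < n) r (lift ord_max j).

Hypothesis Gdr : arithmetical_structure G d r.

Lemma arith_row i : d i * r i = \sum_j mult G i j * r j.
Proof.
case: Gdr => _ /matrixP/(_ i ord0) + _.
rewrite /laplacian mulmxBl mul_diag_mx !mxE.
move/eqP; rewrite subr_eq0 => /eqP E.
apply: (can_inj absz_nat); rewrite PoszM E (big_morph Posz PoszD (erefl _)).
by apply: eq_bigr => j _; rewrite !mxE PoszM.
Qed.

Lemma kr_d_sub i :
  mult G (lift ord_max i) ord_max * mult G ord_max (lift ord_max i)
    <= d (lift ord_max i) * d ord_max.
Proof.
case: (Gdr) => rpos _ _.
have h a b : mult G a b * r b <= d a * r a.
  by rewrite arith_row (bigD1 b) //= leq_addr.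
have := leq_mul (h (lift ord_max i) ord_max) (h ord_max (lift ord_max i)).
rewrite mulnACA [X in _ <= X]mulnACA [X in _ <= _ * X]mulnC.
by rewrite leq_pmul2r // muln_gt0 !rpos.
Qed.

Lemma kr_matrixE : kr_matrix (laplacian G d) = laplacian kr_graph kr_d.
Proof.
apply/matrixP => i j; rewrite /laplacian !mxE /= /kr_mult.
rewrite (inj_eq (@lift_inj _ ord_max)) eqxx mult_loopless.
rewrite (negbTE (neq_lift _ _)) [lift _ _ == ord_max]eq_sym.
rewrite (negbTE (neq_lift _ _)) !mulr0n !sub0r !subr0 !mulr1n mulrNN.
case: eqP => [<-|_].
  by rewrite !mulr1n mult_loopless !subr0 -subzn ?kr_d_sub // !PoszM.
by rewrite !mulr0n !sub0r PoszD !PoszM opprD mulNr.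
Qed.

Hypotheses (Gconn : connected_graph G) (n_gt0 : 0 < n).

Lemma last_degree_gt0 : 0 < d ord_max.
Proof.
have [rpos _ _] := Gdr.
have /connectP[[|x p] /=] := Gconn ord_max (lift ord_max (Ordinal n_gt0)).
  by move=> _ /eqP; rewrite eq_sym (negbTE (neq_lift _ _)).
case/andP; rewrite /adjacent => adj _ _; rewrite -(ltn_pmul2r (rpos ord_max)) arith_row.
by rewrite (bigD1 x) //= mul0n addn_gt0 muln_gt0 adj rpos.
Qed.

Lemma kr_connected : connected_graph kr_graph.
Proof.
move=> i0 j0.
pose P (y : 'I_n.+1) : Prop := if unlift ord_max y is Some j then connect (adjacent kr_graph) i0 j
  else exists2 j, adjacent G (lift ord_max j) ord_max
                  & connect (adjacent kr_graph) i0 j.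
have stepP y z : adjacent G y z -> P y -> P z.
  rewrite /P; case: (unliftP _ y) => [j ->|->]; case: (unliftP _ z) => [k ->|->].
  - move=> ejk /connect_trans; apply; apply: connect1.
    rewrite /adjacent /= /kr_mult; case: eqP ejk => [->|_ ejk].
      by rewrite /adjacent mult_loopless.
    by rewrite addn_gt0 muln_gt0 last_degree_gt0 andbT (ejk : 0 < _).
  - by move=> ej c; exists j.
  - move=> ek [j ej /connect_trans]; apply.
    have [->|njk] := eqVneq j k; first exact: connect0.
    apply: connect1; rewrite /adjacent /= /kr_mult (negbTE njk).
    by rewrite addn_gt0 !muln_gt0 orbC (ej : 0 < _) (ek : 0 < _).
  - by rewrite /adjacent mult_loopless.
have /connectP[p pth lastp] := Gconn (lift ord_max i0) (lift ord_max j0).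
suff : P (lift ord_max j0) by rewrite /P liftK.
have : P (lift ord_max i0) by rewrite /P liftK connect0.
rewrite lastp; elim: p (@lift n.+1 ord_max i0) pth {lastp} => //= x p IH y /andP[e pth] Py.
exact: IH pth (stepP _ _ e Py).
Qed.

Lemma kr_arithmetical : arithmetical_structure kr_graph kr_d kr_r.
Proof.
have [rpos Lr _] := Gdr.
pose g := \big[gcdn/0]_(j < n) r (lift ord_max j).
have gdvd j : g %| r (lift ord_max j) by exact: biggcdn_inf.
have gpos : 0 < g by apply: dvdn_gt0 (gdvd (Ordinal n_gt0)); exact: rpos.
have rE j : r (lift ord_max j) = kr_r j * g by rewrite divnK.
split.
- by move=> i; rewrite divn_gt0 // dvdn_leq.
- have gN0 : (g%:Z != 0)%R by rewrite -lt0n.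
  apply: (scalemx_inj gN0); rewrite scalemxAr scaler0 -kr_matrixE.
  have Lrow i : (\sum_j laplacian G d i (lift ord_max j) * (r (lift ord_max j))%:Z
                 = - (laplacian G d i ord_max * (r ord_max)%:Z))%R.
    move/matrixP: Lr => /(_ i ord0); rewrite [LHS]mxE [RHS]mxE.
    rewrite (bigD1_ord ord_max) //= [X in (_ * X + _)%R]mxE => /eqP.
    rewrite addrC addr_eq0 => /eqP <-.
    by apply: eq_bigr => j _; rewrite [X in (_ = _ * X)%R]mxE.
  apply/matrixP => i j; rewrite [LHS]mxE [RHS]mxE.
  transitivity (\sum_j (laplacian G d ord_max ord_max
        * (laplacian G d (lift ord_max i) (lift ord_max j)
           * (r (lift ord_max j))%:Z)
      - laplacian G d (lift ord_max i) ord_max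
        * (laplacian G d ord_max (lift ord_max j)
           * (r (lift ord_max j))%:Z)))%R.
    apply: eq_bigr => l _; rewrite [kr_matrix _ _ _]mxE.
    rewrite [X in (_ * X = _)%R]mxE [X in (_ * (_ * X) = _)%R]mxE.
    rewrite rE mulnC PoszM mulrBl !mulrA; congr (_ * _ * _ - _)%R.
    exact: mulrC.
  rewrite big_split /= sumrN -!mulr_sumr !Lrow !mulrN opprK addrC mulrCA.
  exact: subrr.
- apply/eqP; rewrite -(eqn_pmul2r gpos) mul1n; apply/eqP.
  rewrite (big_morph (fun x => x * g) (fun x y => muln_gcdl x y g) (mul0n g)).
  by rewrite -[RHS]/(\big[gcdn/0]_(j < n) r (lift ord_max j));
     apply: eq_bigr => j _; rewrite rE.
Qed.

End KeyesReiter.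

Lemma D0 m n (B : 'M[int]_(m, n)) : D 0 B = 1.
Proof.
have incr p (f : {ffun 'I_0 -> 'I_p}) : increasing_map f by apply/forallP => -[].
have e p : {f : {ffun 'I_0 -> 'I_p} | forall f', increasing_map f' = (f' == f)}.
  exists (ffun0 (card_ord 0)) => f'; rewrite incr; apply/esym/eqP/ffunP => -[] //.
have [[f fE] [g gE]] := (e m, e n).
by rewrite /D (big_pred1 f) // (big_pred1 g) // /minor_abs det_mx00.
Qed.

(* Main.v *)
(** Clearing the last row by column operations (Chio) turns each minor of [L']
  into a power of [d_n] times a minor of [L] through the last row and column,
  which gives (a), and then (b).

  For (c), let [q] divide all star minors of [L] of size [m >= 2], those using
  the last row and the last column.  If [A] is a star submatrix of size
  [m + 1], then modulo [q] the relation [A * adj A = det A] reduces to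
  [b_i z_j = delta_ij det A], where [b] is the last column of [A], [z] its
  vector of cofactors, and [i], [j] are not the last row.  As [b z] has rank
  one and there are at least two such rows, a Bezout argument gives
  [q | det A].  Expanding minors bordered by one more row and column then shows
  that [q] divides each entry of the last column times each minor using the
  last row, and that each entry of the last row times an arbitrary minor is a
  combination of minors using the last row.  Hence [q | g_n^2 D_m(L)].

  The inequalities (d) also need [D_{k+1}(L) > 0]: a maximum principle for the
  quotients [|v_i| / r_i] shows that proper principal minors of [L] are
  nonzero. *)

Require Import Defs.
From mathcomp Require Import all_boot all_order all_algebra all_fingroup.

Set Implicit Arguments.
Unset Strict Implicit.
Unset Printing Implicit Defensive.

Import GRing.Theory Num.Theory.

(** * Minors along arbitrary, not necessarily increasing, index maps *)

Section Minors.

Local Open Scope ring_scope.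

Definition hits m N (x : 'I_N) (f : 'I_m -> 'I_N) := [exists i, f i == x].

(** The new index goes first, so that bordered matrices expand along [ord0] and have their pivot in
    the upper left corner; index order affects only signs. *)
Definition ocons m N (x : 'I_N) (f : 'I_m -> 'I_N) (i : 'I_m.+1) : 'I_N :=
  oapp f x (unlift ord0 i).

Lemma ocons0 m N (x : 'I_N) (f : 'I_m -> 'I_N) : ocons x f ord0 = x.
Proof. by rewrite /ocons unlift_none. Qed.

Lemma oconsS m N (x : 'I_N) (f : 'I_m -> 'I_N) i :
  ocons x f (lift ord0 i) = f i.
Proof. by rewrite /ocons liftK. Qed.

Lemma hits_ocons m N (x : 'I_N) (f : 'I_m -> 'I_N) : hits x (ocons x f).
Proof. by apply/existsP; exists ord0; rewrite ocons0. Qed.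

Lemma hits_oconsS m N (x y : 'I_N) (f : 'I_m -> 'I_N) :
  hits x f -> hits x (ocons y f).
Proof.
by case/existsP=> i fi; apply/existsP; exists (lift ord0 i); rewrite oconsS.
Qed.

Lemma hits_lift m N (x : 'I_N) (f : 'I_m.+1 -> 'I_N) i0 i :
  f i0 = x -> i != i0 -> hits x (f \o lift i).
Proof.
move=> fx; case/unlift_some=> j jE _.
by apply/existsP; exists j; rewrite /= -jE fx.
Qed.

Lemma sort_ord_fun m N (f : 'I_m -> 'I_N) : injective f ->
  exists h : {ffun 'I_m -> 'I_N}, exists s : 'S_m,
    increasing_map h /\ f =1 h \o s.
Proof.
move=> finj; pose t := [tuple f i | i < m].
pose leT := (fun x y : 'I_N => (x <= y)%N).
have szt : size (sort leT t) == m by rewrite size_sort size_tuple.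
pose st := Tuple szt.
have /tuple_permP[p /val_inj tE] : perm_eq t st by rewrite perm_sym perm_sort.
have stinj : injective (tnth st).
  apply/tuple_uniqP; rewrite sort_uniq.
  by apply/tuple_uniqP => i j; rewrite !tnth_mktuple; apply: finj.
exists [ffun i => tnth st i], p; split; last first.
  move=> i; have := congr1 (fun u => tnth u i) tE.
  by rewrite !tnth_mktuple /= ffunE.
apply/forallP => i; apply/forallP => j; apply/implyP => ij; rewrite !ffunE.
rewrite ltn_neqAle (inj_eq val_inj) (inj_eq stinj) neq_ltn ij /=.
rewrite !(tnth_nth (f i)).
apply: (@sorted_ltn_nth _ leT) => //=.
- by move=> a b c; apply: leq_trans.
- by apply: sort_sorted => a b; apply: leq_total.
- by rewrite inE (eqP szt).
- by rewrite inE (eqP szt).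
Qed.

Lemma det_mxsub_row_perm m M N (B : 'M[int]_(M, N)) f g (s : 'S_m) :
  \det (mxsub (f \o s) g B) = (-1) ^+ s * \det (mxsub f g B).
Proof.
have -> : mxsub (f \o s) g B = row_perm s (mxsub f g B).
  by apply/matrixP => i j; rewrite !mxE.
by rewrite row_permE det_mulmx det_perm.
Qed.

Lemma det_mxsub_tr m M N (B : 'M[int]_(M, N)) (f : 'I_m -> _) g :
  \det (mxsub f g B) = \det (mxsub g f B^T).
Proof.
by rewrite -det_tr; congr (\det _); apply/matrixP => i j; rewrite !mxE.
Qed.

Lemma abs_det_mxsub_perm m M N (B : 'M[int]_(M, N)) f g (s t : 'S_m) :
  absz (\det (mxsub (f \o s) (g \o t) B)) = absz (\det (mxsub f g B)).
Proof.
rewrite det_mxsub_row_perm det_mxsub_tr det_mxsub_row_perm -det_mxsub_tr.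
by rewrite !abszMsign.
Qed.

Lemma det_mxsub_noninj m M N (B : 'M[int]_(M, N)) (f : 'I_m -> _) g :
  ~ injective f -> \det (mxsub f g B) = 0.
Proof.
move/injectiveP/injectivePn=> [i [j ij fij]].
by apply: (determinant_alternate ij) => l; rewrite !mxE fij.
Qed.

(** A repeated index makes the minor vanish, and sorting distinct indices changes only its sign.
    Keeping [hits] serves [Dstar] as well as [D]. *)
Lemma minor_abs_sort m M N (B : 'M[int]_(M, N)) (f : 'I_m -> _) g :
  \det (mxsub f g B) = 0 \/
  exists (h1 : {ffun 'I_m -> 'I_M}) (h2 : {ffun 'I_m -> 'I_N}),
    [/\ increasing_map h1 /\ (forall x, hits x f -> hits x h1),
    increasing_map h2 /\ (forall x, hits x g -> hits x h2)
    & absz (\det (mxsub f g B)) = minor_abs B h1 h2].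
Proof.
have [/injectiveP finj|/injectiveP fN] := boolP (injectiveb f); last first.
  by left; apply: det_mxsub_noninj.
have [/injectiveP ginj|/injectiveP gN] := boolP (injectiveb g); last first.
  by left; rewrite det_mxsub_tr; apply: det_mxsub_noninj.
have [h1 [s [h1i fE]]] := sort_ord_fun finj.
have [h2 [t [h2i gE]]] := sort_ord_fun ginj.
right; exists h1, h2; split.
- by split=> // x /existsP[i]; rewrite fE => hx; apply/existsP; exists (s i).
- by split=> // x /existsP[i]; rewrite gE => hx; apply/existsP; exists (t i).
rewrite /minor_abs -(abs_det_mxsub_perm B h1 h2 s t); congr (absz (\det _)).
by apply/matrixP => i j; rewrite !mxE fE gE.
Qed.

Lemma D_dvd_minor m M N (B : 'M[int]_(M, N)) (f : 'I_m -> _) g :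
  ((D m B)%:Z %| \det (mxsub f g B))%Z.
Proof.
have [->|[h1 [h2 [[i1 _] [i2 _] e]]]] := minor_abs_sort B f g.
  exact: dvdz0.
rewrite dvdzE e; apply: (biggcdn_inf h1) => //.
exact: (biggcdn_inf h2).
Qed.

Lemma Dstar_dvd_minor m M N (B : 'M[int]_(M.+1, N.+1)) (f : 'I_m -> _) g :
  hits ord_max f -> hits ord_max g -> ((Dstar m B)%:Z %| \det (mxsub f g B))%Z.
Proof.
move=> fx gx.
have [->|[h1 [h2 [[i1 x1] [i2 x2] e]]]] := minor_abs_sort B f g.
  exact: dvdz0.
rewrite dvdzE e; apply: (biggcdn_inf h1); first by rewrite i1; apply: x1.
by apply: (biggcdn_inf h2) => //; rewrite i2; apply: x2.
Qed.

Lemma D_dvd_Dstar m M N (B : 'M[int]_(M.+1, N.+1)) : (D m B %| Dstar m B)%N.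
Proof.
apply/dvdn_biggcdP => f _; apply/dvdn_biggcdP => g _; exact: D_dvd_minor.
Qed.

Lemma mul_biggcdn (I : finType) (P : pred I) (F : I -> nat) c :
  (c * \big[gcdn/0]_(i | P i) F i = \big[gcdn/0]_(i | P i) (c * F i))%N.
Proof. exact: (big_morph _ (muln_gcdr c) (muln0 c)). Qed.

Lemma dvd_mul_D q c m M N (B : 'M[int]_(M, N)) :
  (forall f g : 'I_m -> _, (q%:Z %| c%:Z * \det (mxsub f g B))%Z) -> (q %| c * D m B)%N.
Proof.
move=> qB; rewrite /D mul_biggcdn; apply/dvdn_biggcdP => f _.
rewrite mul_biggcdn; apply/dvdn_biggcdP => g _.
by have := qB f g; rewrite dvdzE abszM.
Qed.

(** Transpositions of rows and of columns bring [ord_max] to the front of any star minor without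
    changing its absolute value. *)
Lemma dvd_mul_Dstar q c m M N (B : 'M[int]_(M.+1, N.+1)) :
  (forall f g : 'I_m -> _,
     (q%:Z %| c%:Z * \det (mxsub (ocons ord_max (lift ord_max \o f))
                                    (ocons ord_max (lift ord_max \o g)) B))%Z) ->
  (q %| c * Dstar m.+1 B)%N.
Proof.
have key K (f : {ffun 'I_m.+1 -> 'I_K.+1}) :
    increasing_map f && [exists i, f i == ord_max] ->
    exists (h : 'I_m -> 'I_K) (s : 'S_m.+1), f =1 ocons ord_max (lift ord_max \o h) \o s.
  case/andP=> /forallP finc /existsP[i0 /eqP fi0].
  have finj : injective f.
    move=> i j fij; apply/eqP; rewrite -(inj_eq val_inj); apply/negP => /negP.
    rewrite neq_ltn => /orP[] lt.
      by have := implyP (forallP (finc i) j) lt; rewrite fij ltnn.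
    by have := implyP (forallP (finc j) i) lt; rewrite fij ltnn.
  pose s := tperm i0 ord0.
  have fsN i : {j | f (s (lift ord0 i)) = lift ord_max j}.
    case: (unliftP ord_max (f (s (lift ord0 i)))) => [j jE|]; first by exists j.
    rewrite -fi0 => /finj /(canRL (tpermK _ _)); rewrite tpermL => /eqP.
    by rewrite eq_sym (negbTE (neq_lift _ _)).
  exists (fun i => sval (fsN i)), s => i /=.
  rewrite -{1}(tpermK i0 ord0 i) -/s; case: (unliftP ord0 (s i)) => [j|] ->.
    by rewrite oconsS /=; case: (fsN j).
  by rewrite ocons0 tpermR.
move=> qB; rewrite /Dstar mul_biggcdn; apply/dvdn_biggcdP => f /key[f' [s fE]].
rewrite mul_biggcdn; apply/dvdn_biggcdP => g /key[g' [t gE]].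
have := qB f' g'; rewrite dvdzE abszM.
rewrite -(abs_det_mxsub_perm B _ _ s t) /minor_abs.
congr (_ %| c * absz (\det _))%N.
by apply/matrixP => i j; rewrite !mxE fE gE.
Qed.

Lemma cofactor_mxsub m M N (B : 'M[int]_(M, N)) (f : 'I_m.+1 -> _) g i j :
  cofactor (mxsub f g B) i j =
  (-1) ^+ (i + j) * \det (mxsub (f \o lift i) (g \o lift j) B).
Proof.
by rewrite /cofactor; congr (_ * \det _); apply/matrixP => a b; rewrite !mxE.
Qed.

(* Modulo [q] the matrix [b z^T] is [E] times the identity.  With
   [c_i := b_i / gcd(b1, b2)], the relation [c1 * b2 = c2 * b1] kills both
   [c1 * E] and [c2 * E]. *)
Lemma dvdz_two_rows (q E b1 b2 z1 z2 : int) :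
  (q %| E - b1 * z1)%Z -> (q %| E - b2 * z2)%Z ->
  (q %| b1 * z2)%Z -> (q %| b2 * z1)%Z -> (q %| E)%Z.
Proof.
move=> q11 q22 q12 q21.
have [g0|gN0] := eqVneq (gcdz b1 b2) 0.
  by move/eqP: g0 q11; rewrite gcdz_eq0 => /andP[/eqP-> _]; rewrite mul0r subr0.
have [/dvdzP[c1 b1E] /dvdzP[c2 b2E]] := (dvdz_gcdl b1 b2, dvdz_gcdr b1 b2).
have [u [v uvE]] := Bezoutz b1 b2.
set g := gcdz b1 b2 in gN0 b1E b2E uvE.
have uv1 : u * c1 + v * c2 = 1.
  by apply: (mulIf gN0); rewrite mul1r mulrDl -!mulrA -b1E -b2E.
have q1 : (q %| c1 * E)%Z.
  rewrite -[E](subrK (b2 * z2)) mulrDr rpredD //; first exact: dvdz_mull.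
  have -> : c1 * (b2 * z2) = c2 * (b1 * z2).
    by rewrite !mulrA b1E b2E mulrCA mulrA.
  exact: dvdz_mull.
have q2 : (q %| c2 * E)%Z.
  rewrite -[E](subrK (b1 * z1)) mulrDr rpredD //; first exact: dvdz_mull.
  have -> : c2 * (b1 * z1) = c1 * (b2 * z1).
    by rewrite !mulrA b1E b2E mulrCA mulrA.
  exact: dvdz_mull.
by rewrite -[E]mul1r -uv1 mulrDl -!mulrA rpredD // dvdz_mull.
Qed.

(** In entry [(i, i')] of [A *m \adj A], every term except that of column [j0] vanishes modulo
    [q]. *)
Lemma dvdz_mul_adj (q : int) m (A : 'M[int]_m) i i' j0 :
  (forall j, j != j0 -> (q %| cofactor A i' j)%Z) ->
  (q %| \det A *+ (i == i') - A i j0 * cofactor A i' j0)%Z.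
Proof.
move=> qA; have /matrixP/(_ i i') := mul_mx_adj A; rewrite !mxE => <-.
rewrite (bigD1 j0) //= [X in _ * X + _]mxE addrAC subrr add0r.
by apply: rpred_sum => j jj0; rewrite mxE dvdz_mull ?qA.
Qed.

(** * Consequences of a common divisor of the star minors *)

Section Star.
Variables (M N : nat) (B : 'M[int]_(M, N)) (x : 'I_M) (y : 'I_N) (q : int).

Lemma dvd_star_minorS m :
  (forall f g : 'I_m.+2 -> _, hits x f -> hits y g ->
     (q %| \det (mxsub f g B))%Z) ->
  forall f g : 'I_m.+3 -> _, hits x f -> hits y g ->
     (q %| \det (mxsub f g B))%Z.
Proof.
move=> qB f g /existsP[i0 /eqP fi0] /existsP[j0 /eqP gj0].
set A := mxsub f g B.
have qA i j : i != i0 -> j != j0 -> (q %| cofactor A i j)%Z.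
  move=> ii0 jj0; rewrite cofactor_mxsub dvdz_mull //.
  by apply: qB; [apply: hits_lift ii0 | apply: hits_lift jj0].
have adj i i' : i' != i0 ->
    (q %| \det A *+ (i == i') - A i j0 * cofactor A i' j0)%Z.
  by move=> i'i0; apply: dvdz_mul_adj => j; apply: qA.
(* Size at least three leaves two rows besides [i0] for the Bezout argument. *)
pose i1 := lift i0 ord0; pose i2 := lift i0 (lift ord0 ord0).
have i1N : i1 != i0 by rewrite eq_sym neq_lift.
have i2N : i2 != i0 by rewrite eq_sym neq_lift.
have i12 : i1 == i2 = false by rewrite (inj_eq lift_inj) (negbTE (neq_lift _ _)).
apply: (dvdz_two_rows (b1 := A i1 j0) (b2 := A i2 j0)
          (z1 := cofactor A i1 j0) (z2 := cofactor A i2 j0)).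
- by have := adj i1 i1 i1N; rewrite eqxx.
- by have := adj i2 i2 i2N; rewrite eqxx.
- by have := adj i1 i2 i2N; rewrite i12 mulr0n sub0r rpredN.
- by have := adj i2 i1 i1N; rewrite eq_sym i12 mulr0n sub0r rpredN.
Qed.

(** Bordering by row [i] and column [y] gives a larger star minor. In its expansion along the new
    row, all cofactors but the corner one keep row [x] and column [y]. *)
Lemma dvd_col_entry_mul_minor m i :
  (forall f g : 'I_m.+2 -> _, hits x f -> hits y g ->
     (q %| \det (mxsub f g B))%Z) ->
  forall f g : 'I_m.+2 -> _, hits x f ->
     (q %| B i y * \det (mxsub f g B))%Z.
Proof.
move=> qB f g fx; pose A := mxsub (ocons i f) (ocons y g) B.
have qdet : (q %| \det A)%Z.
  by apply: (dvd_star_minorS qB); [apply: hits_oconsS | apply: hits_ocons].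
move: qdet; rewrite (expand_det_row A ord0) (bigD1 ord0) //= rpredDr.
  rewrite cofactor_mxsub mxE !ocons0 /= expr0 mul1r.
  congr (_ %| _ * \det _)%Z.
  by apply/matrixP => a b; rewrite !mxE /= !oconsS.
apply: rpred_sum => j jN; rewrite cofactor_mxsub !dvdz_mull //.
apply: qB; last by apply: hits_lift jN; apply: ocons0.
case/existsP: fx => a fa; apply/existsP; exists a.
by rewrite /= oconsS.
Qed.

(** The minor bordered by row [x] and column [j] is expanded twice: along an old row, where every
    cofactor keeps row [x], and along the new column, where only the corner cofactor loses it. *)
Lemma dvd_row_entry_mul_minor m c j :
  (forall f g : 'I_m.+1 -> _, hits x f -> (q %| c * \det (mxsub f g B))%Z) ->
  forall f g : 'I_m.+1 -> _, (q %| c * (B x j * \det (mxsub f g B)))%Z.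
Proof.
move=> qB f g; pose A := mxsub (ocons x f) (ocons j g) B.
have qcof a b : a != ord0 -> (q %| c * (A a b * cofactor A a b))%Z.
  move=> aN; rewrite cofactor_mxsub mulrCA dvdz_mull //.
  rewrite mulrCA dvdz_mull //.
  by apply: qB; apply: hits_lift aN; apply: ocons0.
have : (q %| c * \det A)%Z.
  rewrite (expand_det_row A (lift ord0 ord0)) mulr_sumr.
  by apply: rpred_sum => b _; apply: qcof.
rewrite (expand_det_col A ord0) mulr_sumr (bigD1 ord0) //= rpredDr.
  rewrite cofactor_mxsub mxE !ocons0 /= expr0 mul1r.
  congr (_ %| _ * (_ * \det _))%Z.
  by apply/matrixP => a b; rewrite !mxE /= !oconsS.
by apply: rpred_sum => a aN; apply: qcof.
Qed.

End Star.
End Minors.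

(** * Chio condensation and gcds of minors *)

Section DeterminantalDivisors.

Local Open Scope ring_scope.

Lemma Dstar_dvd_mul_D m M N (B : 'M[int]_(M.+1, N.+1)) :
  (Dstar m.+2 B %| last_row_gcd B^T * last_row_gcd B * D m.+2 B)%N.
Proof.
have qR (f g : 'I_m.+2 -> _) : hits ord_max f ->
    ((Dstar m.+2 B)%:Z %| (last_row_gcd B^T)%:Z * \det (mxsub f g B))%Z.
  move=> fx; rewrite dvdzE abszM mulnC mul_biggcdn.
  apply/dvdn_biggcdP => i _; rewrite mxE -abszM -dvdzE mulrC.
  apply: (dvd_col_entry_mul_minor (x := ord_max)) => // f' g'.
  exact: Dstar_dvd_minor.
apply: dvd_mul_D => f g; rewrite dvdzE abszM absz_nat mulnAC mul_biggcdn.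
apply/dvdn_biggcdP => j _.
have := dvd_row_entry_mul_minor j qR f g.
by rewrite dvdzE !abszM absz_nat mulnA mulnAC.
Qed.

Lemma chio m n (B : 'M[int]_n.+1) (f g : 'I_m.+1 -> 'I_n) :
  B ord_max ord_max != 0 ->
  \det (mxsub f g (kr_matrix B)) = B ord_max ord_max ^+ m *
    \det (mxsub (ocons ord_max (lift ord_max \o f))
                (ocons ord_max (lift ord_max \o g)) B).
Proof.
move=> d0; set d := B _ _ in d0 *; set X := mxsub (ocons _ _) _ _.
pose c : 'rV_m.+1 := \row_j B ord_max (lift ord_max (g j)).
pose b : 'cV_m.+1 := \col_i B (lift ord_max (f i)) ord_max.
pose A := mxsub (lift ord_max \o f) (lift ord_max \o g) B.
have XE : X = block_mx (d%:M : 'M_1) c b A :> 'M_(1 + m.+1).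
  rewrite -[LHS](@submxK _ 1 m.+1 1 m.+1); congr block_mx; apply/matrixP => i j; rewrite !mxE.
  - by rewrite [i]ord1 [j]ord1 lshift0 !ocons0 eqxx.
  - by rewrite [i]ord1 lshift0 rshift1 ocons0 oconsS.
  - by rewrite [j]ord1 lshift0 rshift1 ocons0 oconsS.
  - by rewrite !rshift1 !oconsS.
have KE : mxsub f g (kr_matrix B) = - (b *m c) + d *: A.
  apply/matrixP => i j; rewrite !mxE big_ord1 !mxE addrC.
  by congr (_ + _); rewrite mulrC.
(* The right factor clears the row [c], since [d * (- c) + c * d = 0], and turns the lower right
   block into [d *: A - b *m c]. *)
have : \det (block_mx (d%:M : 'M_1) c b A *m block_mx 1%:M (- c) 0 d%:M)
    = d * \det (mxsub f g (kr_matrix B)).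
  rewrite mulmx_block !mulmx1 !mulmx0 !addr0 mul_scalar_mx mul_mx_scalar.
  rewrite scalerN addNr mulmxN mul_mx_scalar -KE det_lblock.
  by rewrite det_scalar expr1.
(* The right factor has determinant [d ^+ m.+1]; cancelling one [d] leaves the exponent [m]. *)
rewrite det_mulmx -XE det_ublock det1 mul1r det_scalar => e.
by apply: (mulfI d0); rewrite -e mulrA -exprS mulrC.
Qed.

Lemma D_kr_matrix m n (B : 'M[int]_n.+1) : B ord_max ord_max != 0 ->
  D m.+1 (kr_matrix B) = (absz (B ord_max ord_max) ^ m * Dstar m.+2 B)%N.
Proof.
move=> d0; apply/eqP; rewrite eqn_dvd; apply/andP; split.
  apply: dvd_mul_Dstar => f g; rewrite dvdzE abszM !absz_nat -abszX -abszM.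
  by rewrite -chio //; exact: D_dvd_minor.
rewrite -[D _ _]mul1n; apply: dvd_mul_D => f g.
rewrite mul1r chio // dvdzE abszM !absz_nat abszX dvdn_mul //.
by apply: (Dstar_dvd_minor B); apply: hits_ocons.
Qed.

End DeterminantalDivisors.

(** * Nonvanishing of proper principal minors *)

Section Positivity.

Variables (n : nat) (G : multigraph n.+1) (d r : 'I_n.+1 -> nat).
Hypotheses (Gconn : connected_graph G) (Gdr : arithmetical_structure G d r).

(* Maximum principle for [a / r]; [c] is this quotient scaled to be integral. *)
Lemma subharmonic_eq0 (a : 'I_n.+1 -> nat) j0 :
  (forall i, d i * a i <= \sum_j mult G i j * a j) -> a j0 = 0 ->
  forall i, a i = 0.
Proof.
move=> sub aj0; have [rpos _ _] := Gdr.
pose P := \prod_j r j; pose c i := a i * \prod_(j | j != i) r j.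
have cE i : a i * P = c i * r i.
  by rewrite /P (bigD1 i) //= /c -mulnA [r i * _]mulnC.
have Ppos : 0 < P by apply: prodn_gt0.
case: (@arg_maxnP _ j0 predT c isT) => i1 _ cmax.
(* Since [r] satisfies the inequality [sub] with equality, a neighbour with smaller [c] would
   violate [sub] at the maximum [i]. *)
have step i j : adjacent G i j -> c i = c i1 -> c j = c i1.
  move=> ij ci; apply/eqP; rewrite eqn_leq [_ <= _]cmax //= leqNgt.
  apply/negP => lt.
  have : P * (d i * a i) <= P * \sum_j mult G i j * a j.
    by rewrite leq_mul2l sub orbT.
  rewrite mulnCA [P * _]mulnC cE ci mulnCA (arith_row Gdr) !big_distrr /=.
  apply/negP; rewrite -ltnNge (bigD1 j) //= [ltnRHS](bigD1 j) //=.
  rewrite -addSn leq_add //.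
    rewrite mulnCA [P * _]mulnC cE [ltnRHS]mulnCA ltn_pmul2l //.
    by rewrite ltn_pmul2r ?rpos.
  apply: leq_sum => l _.
  rewrite mulnCA [P * _]mulnC cE [leqRHS]mulnCA leq_mul2l leq_mul2r.
  by rewrite [c l <= _]cmax ?orbT.
have cj0 : c j0 = c i1.
  have /connectP[p pth ->] := Gconn i1 j0.
  suff cp i : c i = c i1 -> path (adjacent G) i p -> c (last i p) = c i1.
    exact: cp.
  elim: p i {pth} => //= x p IH i ci /andP[ix].
  exact: IH (step _ _ ix ci).
move=> i; apply/eqP; rewrite -(eqn_pmul2r Ppos) mul0n cE.
have : c i <= c i1 by apply: cmax.
by rewrite -cj0 /c aj0 mul0n leqn0 => /eqP->.
Qed.

Lemma absz_sum_leq (I : finType) (F : I -> int) :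
  absz (\sum_i F i)%R <= \sum_i absz (F i).
Proof.
elim/big_ind2: _ => // x1 x2 y1 y2 le1 le2.
apply: leq_trans (leq_add le1 le2).
by rewrite -lez_nat PoszD !abszE ler_normD.
Qed.

Lemma laplacian_tr : ((laplacian G d)^T = laplacian G d)%R.
Proof.
apply/matrixP => i j; rewrite !mxE mult_sym; congr (_ - _)%R.
by have [->|_] := eqVneq j i; rewrite ?eqxx // !mulr0n.
Qed.

Lemma laplacian_diag i : laplacian G d i i = d i.
Proof. by rewrite !mxE eqxx mult_loopless subr0. Qed.

(** Absolute values of a kernel vector, extended by zero, are subharmonic by the triangle inequality
    and vanish at [x], hence everywhere. *)
Lemma proper_principal_minor_neq0 m (f : 'I_m -> 'I_n.+1) x :
  injective f -> ~~ hits x f ->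
  (\det (mxsub f f (laplacian G d)) != 0)%R.
Proof.
move=> finj fx; apply/negP => /det0P[v /eqP v0 vM]; apply: v0.
pose a j := \sum_(i | f i == j) absz (v ord0 i).
have af i : a (f i) = absz (v ord0 i).
  by rewrite /a (big_pred1 i) // => i'; rewrite (inj_eq finj).
have a0 j : ~~ hits j f -> a j = 0.
  move=> jN; rewrite /a big1 // => i fi; case/existsP: jN.
  by exists i.
have aS : forall i, d i * a i <= \sum_j mult G i j * a j.
  move=> j; have [/existsP[i /eqP <-]|/a0->] := boolP (hits j f); last first.
    by rewrite muln0.
  have -> : \sum_j mult G (f i) j * a j
      = \sum_i' mult G (f i) (f i') * absz (v ord0 i').
    rewrite (partition_big f xpredT) //=; apply: eq_bigr => l _.
    by rewrite /a big_distrr /=; apply: eq_bigr => i' /eqP->.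
  have : (v ord0 i * (d (f i))%:Z
          = \sum_i' v ord0 i' * (mult G (f i) (f i'))%:Z)%R.
    move/matrixP: vM => /(_ ord0 i); rewrite !mxE.
    under eq_bigr => i' _ do rewrite !mxE mulrBr (inj_eq finj) mult_sym.
    rewrite sumrB (bigD1 i) //= eqxx mulr1n big1 => [|i' /negbTE->].
      by rewrite addr0 => /eqP; rewrite subr_eq0 => /eqP.
    by rewrite mulr0n mulr0.
  move/(congr1 absz); rewrite abszM absz_nat -af mulnC => ->.
  apply: leq_trans (absz_sum_leq _) _.
  by apply: leq_sum => i' _; rewrite abszM absz_nat mulnC.
apply/matrixP => i0 i; rewrite [i0]ord1 mxE; apply/eqP; rewrite -absz_eq0 -af.
by apply/eqP; apply: (subharmonic_eq0 aS (a0 _ fx)).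
Qed.

End Positivity.

Lemma D_laplacian_gt0 n (G : multigraph n.+1) (d r : 'I_n.+1 -> nat) m :
  connected_graph G -> arithmetical_structure G d r -> m <= n ->
  0 < D m (laplacian G d).
Proof.
move=> Gconn Gdr mn; pose f (i : 'I_m) := lift ord_max (widen_ord mn i).
have finj : injective f by move=> i j /lift_inj /(congr1 val) /= /val_inj.
have fN : ~~ hits ord_max f.
  by apply/existsP => -[i]; rewrite eq_sym (negbTE (neq_lift _ _)).
rewrite lt0n; apply/eqP => D0; have := D_dvd_minor (laplacian G d) f f.
rewrite D0 dvd0z; apply/negP.
exact: (proper_principal_minor_neq0 Gconn Gdr finj fN).
Qed.

Theorem theorem4p3 (n : nat) (G : multigraph n.+1) (d r : 'I_n.+1 -> nat)
    (Gconn : connected_graph G) (Gdr : arithmetical_structure G d r)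
    (k : nat) (hk : 1 <= k <= n.+1 - 2) :
  let L := laplacian G d in
  let L' := kr_matrix L in
  let dn := d ord_max in
  let gn := last_row_gcd L in
  [/\ D k L' = dn ^ (k - 1) * Dstar k.+1 L,
      dn ^ (k - 1) * D k.+1 L %| D k L',
      D k L' %| gn ^ 2 * dn ^ (k - 1) * D k.+1 L
    & dn ^ (k - 1) * D k.+1 L <= D k L' <= gn ^ 2 * dn ^ (k - 1) * D k.+1 L].
Proof.
move=> L L' dn gn; case: k hk => // m; rewrite subn2 /= => mn.
have n_gt0 : 0 < n by case: n mn {G d r Gconn Gdr L L' dn gn}.
have dn_gt0 : 0 < dn := last_degree_gt0 Gdr Gconn n_gt0.
have Lmm : L ord_max ord_max = dn by apply: laplacian_diag.
have Lmm0 : (L ord_max ord_max != 0)%R by rewrite Lmm -lt0n.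
have eA : D m.+1 L' = dn ^ (m.+1 - 1) * Dstar m.+2 L.
  by rewrite /L' D_kr_matrix // Lmm absz_nat subn1.
have dB : dn ^ (m.+1 - 1) * D m.+2 L %| D m.+1 L'.
  by rewrite eA dvdn_mul // D_dvd_Dstar.
have dC : D m.+1 L' %| gn ^ 2 * dn ^ (m.+1 - 1) * D m.+2 L.
  rewrite eA [gn ^ 2 * _]mulnC -mulnA dvdn_mul //.
  (* Symmetry of [L] identifies the gcds of its last column and last row, whence the square. *)
  by have := Dstar_dvd_mul_D m L; rewrite laplacian_tr mulnn.
have gn_gt0 : 0 < gn.
  rewrite (dvdn_gt0 dn_gt0) //.
  by apply: (biggcdn_inf ord_max) => //; rewrite [B in absz B]Lmm.
(* The bound on [k] gives [m.+2 <= n], so some principal minor of this size avoids the last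
   vertex. *)
have DL_gt0 : 0 < D m.+2 L.
  by apply: (D_laplacian_gt0 Gconn Gdr); rewrite -ltn_predRL.
have rhs_gt0 : 0 < gn ^ 2 * dn ^ (m.+1 - 1) * D m.+2 L.
  by rewrite !muln_gt0 !expn_gt0 gn_gt0 dn_gt0.
split=> //; apply/andP; split; apply: dvdn_leq => //.
exact: dvdn_gt0 dC.
Qed.
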